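(* Up to permutations of the point set there is exactly one $3$-$(11,5,1)$ covering with $20$ blocks. Its automorphism group has order $240$, so there are exactly $166{,}320$ labelled $3$-$(11,5,1)$ coverings with $20$ blocks on the fixed point set $\{1,\dots,11\}$.
   Context: Let $v \ge k \ge t \ge 1$ and let $X$ be a set of $v$ points. A $t$-$(v,k,1)$ covering is a pair $(X,\mathcal{B})$ where $\mathcal{B}$ is a set of $k$-subsets of $X$ (called blocks) such that every $t$-subset of $X$ is contained in at least one block of $\mathcal{B}$. The symmetric group on $X$ acts on coverings by permuting points; two coverings on $X$ are the same up to permutations of the point set if they lie in the same orbit, and the automorphism group of a covering is its stabiliser in this action, i.e. the group of permutations of $X$ mapping $\mathcal{B}$ to itself. *)

(* Defs.v *)
(* MathComp. *)
From mathcomp Require Export all_boot all_fingroup.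

Set Implicit Arguments.
Unset Strict Implicit.
Unset Printing Implicit Defensive.

(* A covering is identified with its block set, the point set being the whole
   finite type [X]. *)
Definition is_covering (X : finType) (t v k : nat) (B : {set {set X}}) : bool :=
  [&& #|X| == v,
      [forall b in B, #|b| == k]
    & [forall T : {set X}, (#|T| == t) ==> [exists b in B, T \subset b]]].

Definition coverings (X : finType) (t v k n : nat) : {set {set {set X}}} :=
  [set B : {set {set X}} | is_covering t v k B & #|B| == n].

(* ['P] is the natural action on points; the first [^*] lifts it to blocks and
   the second to sets of blocks. *)
Definition covering_class (X : finType) (B : {set {set X}}) :
    {set {set {set X}}} :=
  orbit ('P^*^*)%act [set: {perm X}] B.

Definition covering_aut (X : finType) (B : {set {set X}}) : {group {perm X}} :=
  ('C[B | 'P^*^*])%G.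

(* Main.v *)
(* Every point lies in at least C(10,4,2) = 9 blocks and 20 blocks have 100
   incidences, so some point x has degree 9 and its derived design is a covering
   of the pairs of 10 points by 9 quadruples.  A backtracking search with
   Schoenheim-type pruning finds four such derived designs up to isomorphism; in
   each of them every point has degree at most 4.  Hence every point of the
   covering has degree 9 or 10 and every two points lie in at most 4 common
   blocks, and under these caps only one of the four derived designs extends to
   20 blocks, in two isomorphic ways.

   That covering has the points oo and {0,1} x {0,1,2,3,4}, and the blocks
   {oo} u {0,1} x {i,j} with i <> j and {(e,i)} u {(1-e,j) : j <> i}.  A second
   search lists its 240 automorphisms, and 11!/240 = 166320. *)
Require Import Defs.

Set Implicit Arguments.
Unset Strict Implicit.
Unset Printing Implicit Defensive.

(** * Backtracking search for coverings *)

Fixpoint on_support T (g : T -> T) (v : seq bool) (s : seq T) : seq T :=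
  match v, s with
  | b :: v', x :: s' => (if b then g x else x) :: on_support g v' s'
  | _, _ => s
  end.

(* [chunks d 0 m] is the number of [true] in [m] divided by [d], rounded up. *)
Fixpoint chunks d c (m : seq bool) : nat :=
  if m is b :: m' then
    if b then if c is c'.+1 then chunks d c' m' else (chunks d d.-1 m').+1
    else chunks d c m'
  else 0.

(* A state describes the blocks still to be chosen.  Its first component bounds
   their number.  Row x bounds from below ([pneed]) and above ([proom]) how many
   of them contain x; its entry y does the same for the pair {x, y} ([need],
   [room]) and marks the points z for which the triple {x, y, z} is uncovered.
   Diagonal entries cover no triple, and there [room] again bounds the degree
   of x. *)
Record entry := Entry { uncov : seq bool; need : nat; room : nat }.
Record row := Row { pneed : nat; proom : nat; entries : seq entry }.
Definition state := (nat * seq row)%type.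

Notation entry0 := (Entry [::] 0 0).
Notation row0 := (Row 0 0 [::]).

(** A block through two points covers [k - 2] triples on them, whence the division with rounding
    up. *)
Definition mk_entry k m r := Entry m (chunks (k - 2) 0 m) r.

(** Schoenheim's bound: a block through x serves [k - 1] pairs at x, and the quotient is rounded
    up. *)
Definition mk_row k r es :=
  Row ((sumn (map need es) + (k - 2)) %/ (k - 1)) r es.

Definition init n k r (cap : nat -> nat -> nat) (tgt : nat -> nat -> nat -> bool)
    : state :=
  (r, mkseq (fun x => mk_row k (cap x x)
        (mkseq (fun y => mk_entry k (mkseq (tgt x y) n) (cap x y)) n)) n).

Definition add_block k (v : seq bool) (st : state) : state :=
  let upd e := mk_entry k (on_support (fun=> false) v (uncov e)) (room e).-1 in
  let updr r := mk_row k (proom r).-1 (on_support upd v (entries r)) in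
  (st.1.-1, on_support updr v st.2).

(* Only the rows and entries of the block [v] added last have changed. *)
Definition feasible k v (st : state) :=
  all (fun r => (pneed r <= proom r)
                && all (fun e => need e <= room e) (mask v (entries r)))
      (mask v st.2)
  && (sumn (map pneed st.2) <= k * st.1).

Definition admissible (v : seq bool) (st : state) :=
  all (fun r => all (fun e => 0 < room e) (mask v (entries r))) (mask v st.2).

(* Branching on a triple whose pair has the least room keeps the tree small. *)
Fixpoint pick_triple (rs : seq nat) (rows : seq row) :=
  if rs is r :: rs' then
    let P e := (room e <= r) && has id (uncov e) in
    let x := find (fun r => has P (entries r)) rows in
    if x < size rows then
      let es := entries (nth row0 rows x) in
      let y := find P es in
      Some (x, y, find id (uncov (nth entry0 es y)))
    else pick_triple rs' rows
  else None.

(** [j] is the number of points to be added to the prescribed ones. *)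
Fixpoint supersets j (v : seq bool) : seq (seq bool) :=
  if v is b :: v' then
    if b then map (cons true) (supersets j v')
    else (if j is j'.+1 then map (cons true) (supersets j' v') else [::])
         ++ map (cons false) (supersets j v')
  else if j is 0 then [:: [::]] else [::].

Definition indicator n (s : seq nat) := [seq i \in s | i <- iota 0 n].

(** Exhausted fuel yields the partial list [acc] instead of discarding the branch, so the amount of
    fuel never affects soundness. *)
Fixpoint search n k fuel (st : state) (acc : seq (seq bool)) :
    seq (seq (seq bool)) :=
  if fuel is m.+1 then
    if pick_triple (iota 1 fuel) st.2 is Some (x, y, z) then
      flatten
        [seq let st' := add_block k v st in
             if feasible k v st' then search n k m st' (v :: acc) else [::]
           | v <- supersets (k - 3) (indicator n [:: x; y; z]) & admissible v st]
    else [:: acc]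
  else [:: acc].

(** * Boolean lists and the primitives of the search *)

Lemma size_on_support T g v (s : seq T) : size (on_support g v s) = size s.
Proof. by elim: v s => [|b v IHv] [|x s] //=; rewrite IHv. Qed.

Lemma nth_on_support T x0 g v (s : seq T) i : i < size s ->
  nth x0 (on_support g v s) i =
    if nth false v i then g (nth x0 s i) else nth x0 s i.
Proof.
elim: v s i => [|b v IHv] [|x s] [|i] //= lt_i; exact: IHv.
Qed.

Lemma all_mask_nth T x0 (P : pred T) v s :
    (forall i, i < size s -> nth false v i -> P (nth x0 s i)) ->
  all P (mask v s).
Proof.
elim: v s => [|b v IHv] [|x s] //= Ps.
have {}IHv: all P (mask v s) by apply: IHv => i; exact: (Ps i.+1).
by case: b Ps => //= Ps; rewrite IHv andbT; exact: (Ps 0).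
Qed.

(** [c] is the number of places left in a chunk already counted; the induction needs it
    arbitrary. *)
Lemma chunks_le d c m N :
  0 < d -> count id m <= c + d * N -> chunks d c m <= N.
Proof.
move=> d_gt0; elim: m c N => [|[] m IHm] //= c N.
case: c => [|c]; last by rewrite add1n addSn ltnS; exact: IHm.
case: N => [|N]; first by rewrite muln0.
rewrite add0n add1n mulnS -{1}(prednK d_gt0) addSn !ltnS; exact: IHm.
Qed.

Lemma count_sub (w v : seq bool) :
    size v = size w -> (forall i, nth false w i -> nth false v i) ->
  count id w <= count id v.
Proof.
elim: w v => [|b w IHw] [|a v] //= [sz] sub.
rewrite leq_add //; first by case: b sub => // /(_ 0 isT) /= ->.
by apply: IHw => // i; exact: (sub i.+1).
Qed.

Lemma mem_supersets j w v :
    size v = size w -> (forall i, nth false w i -> nth false v i) ->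
    count id v = count id w + j ->
  v \in supersets j w.
Proof.
elim: w v j => [|b w IHw] [|a v] j //=; first by case: j.
case=> sz_v sub_wv; have sub_wv' i : nth false w i -> nth false v i.
  exact: (sub_wv i.+1).
have {sub_wv} := sub_wv 0; case: b => /= [/(_ isT) -> | _].
  by rewrite -addnA => /addnI cv; apply: map_f; exact: IHw.
rewrite add0n mem_cat; case: a => /= cv; last by rewrite map_f ?orbT ?IHw.
case: j cv => [|j] cv.
  by have := count_sub sz_v sub_wv'; rewrite -[leqLHS]addn0 -cv add1n ltnn.
by rewrite map_f // IHw //; move: cv; rewrite addnS add1n => -[].
Qed.

Lemma size_indicator n s : size (indicator n s) = n.
Proof. by rewrite size_map size_iota. Qed.

Lemma nth_indicator n s i : nth false (indicator n s) i = (i < n) && (i \in s).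
Proof.
case: ltnP => lt_in; last by rewrite nth_default // size_indicator.
by rewrite (nth_map 0) ?size_iota // nth_iota.
Qed.

Lemma count_indicator n s :
  uniq s -> all (fun i => i < n) s -> count id (indicator n s) = size s.
Proof.
move=> Us ltsn; rewrite count_map -size_filter; apply/perm_size/uniq_perm => //.
  by rewrite filter_uniq // iota_uniq.
move=> i; rewrite mem_filter mem_iota /=; case: (boolP (i \in s)) => //= si.
by rewrite add0n (allP ltsn).
Qed.

Lemma pick_tripleP rs rows x y z :
    pick_triple rs rows = Some (x, y, z) ->
  let es := entries (nth row0 rows x) in
  [/\ x < size rows, y < size es & nth false (uncov (nth entry0 es y)) z].
Proof.
elim: rs => //= r rs IHrs; case: ifP => // ltx [<- <- <-].
have hasx := nth_find row0 (etrans (has_find _ _) ltx).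
have /andP[_ hasz] := nth_find entry0 hasx.
by split; [|rewrite -has_find|exact: (nth_find false hasz)].
Qed.
Arguments pick_triple : simpl never.

(** * Double counting of codegrees [thru R x y], which are degrees when x = y *)

Definition thru (X : finType) (R : {set {set X}}) x y :=
  #|[set b in R | (x \in b) && (y \in b)]|.

Section Counting.

Variables (X : finType) (k : nat) (R : {set {set X}}).
Hypothesis card_R : forall b, b \in R -> #|b| = k.

Lemma thruC x y : thru R x y = thru R y x.
Proof. by apply: eq_card => b; rewrite !inE [(y \in b) && _]andbC. Qed.

Lemma thruE x y : thru R x y = \sum_(b in R) ((x \in b) && (y \in b)).
Proof.
rewrite /thru -sum1_card (eq_bigl _ _ (fun b => in_set _ b)) big_mkcondr /=.
by apply: eq_bigr => b _; case: ifP.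
Qed.

Lemma thru_sub (R' : {set {set X}}) x y : R \subset R' -> thru R x y <= thru R' x y.
Proof.
move=> sRR'; apply/subset_leq_card/subsetP=> b; rewrite !inE.
by case/andP=> /(subsetP sRR') ->.
Qed.

Lemma sum_thru x : \sum_y thru R x y = k * thru R x x.
Proof.
under eq_bigr do rewrite thruE.
rewrite exchange_big thruE big_distrr /=; apply: eq_bigr => b Rb.
rewrite andbb -(card_R Rb) -sum1_card [in RHS]big_mkcond big_distrl /=.
by apply: eq_bigr => y _; case: (x \in b); case: (y \in b).
Qed.

Lemma sum_thru_neq x : \sum_(y | x != y) thru R x y = (k - 1) * thru R x x.
Proof.
have := sum_thru x; rewrite (bigD1 x) //= => /(canRL (addKn _)).
rewrite mulnBl mul1n => <-; apply: eq_bigl => y; by rewrite eq_sym.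
Qed.

Lemma sum_deg : \sum_x thru R x x = k * #|R|.
Proof.
under eq_bigr do rewrite thruE.
rewrite exchange_big -sum1_card big_distrr /=; apply: eq_bigr => b Rb.
rewrite muln1 -(card_R Rb) -sum1_card [in RHS]big_mkcond.
by apply: eq_bigr => y _; rewrite andbb; case: (y \in b).
Qed.

(** Each block through x and y has [k - 2] further points, and these remainders together cover
    [A]. *)
Lemma leq_thru_cover x y (A : {set X}) : x != y -> A \subset ~: [set x; y] ->
    {in A, forall z, exists2 b, b \in R & [&& x \in b, y \in b & z \in b]} ->
  #|A| <= (k - 2) * thru R x y.
Proof.
move=> neq_xy sA covA; set Rxy := [set b in R | (x \in b) && (y \in b)].
have sAU : A \subset \bigcup_(b in Rxy) (b :\: [set x; y]).
  apply/subsetP=> z Az; have [b Rb /and3P[bx b_y bz]] := covA z Az.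
  apply/bigcupP; exists b; first by rewrite inE Rb bx.
  by rewrite inE bz andbT; move/subsetP/(_ z Az): sA; rewrite inE.
apply: leq_trans (subset_leq_card sAU) _; rewrite /thru -/Rxy mulnC -sum_nat_const.
pose le_card (D : {set X}) m := #|D| <= m.
(* The union bound for two sets is carried over to the whole family. *)
apply: (big_ind2 le_card); rewrite /le_card; first by rewrite cards0.
  by move=> D1 m1 D2 m2 le1 le2; rewrite (leq_trans (leq_card_setU _ _)) ?leq_add.
move=> b.
rewrite inE => /and3P[Rb bx b_y]; rewrite cardsD (card_R Rb).
have /setIidPr -> : [set x; y] \subset b by rewrite subUset !sub1set bx.
by rewrite cards2 neq_xy.
Qed.

End Counting.

(** * Soundness of the search *)

Definition block (X : finType) n (f : 'I_n -> X) (v : seq bool) : {set X} :=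
  [set f i | i : 'I_n & nth false v i].

Definition charvec (X : finType) n (f : 'I_n -> X) (b : {set X}) : seq bool :=
  [seq f i \in b | i <- enum 'I_n].

Section Models.

Variables (X : finType) (n k : nat) (f : 'I_n -> X).
Hypotheses (cardX : #|X| = n) (f_inj : injective f).

Implicit Types (R : {set {set X}}) (i j l : 'I_n) (v : seq bool).

Let f_bij : bijective f.
Proof. by apply: inj_card_bij; rewrite ?cardX ?card_ord. Qed.

Lemma mem_block v i : (f i \in block f v) = nth false v i.
Proof. by rewrite mem_imset ?inE. Qed.

Lemma size_charvec b : size (charvec f b) = n.
Proof. by rewrite size_map size_enum_ord. Qed.

Lemma nth_charvec b i : nth false (charvec f b) i = (f i \in b).
Proof. by rewrite (nth_map i) ?size_enum_ord // nth_ord_enum. Qed.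

Lemma charvecK b : block f (charvec f b) = b.
Proof.
have [g fK gK] := f_bij.
by apply/setP=> x; rewrite -[x]gK mem_block nth_charvec.
Qed.

Lemma blockK v : size v = n -> charvec f (block f v) = v.
Proof.
move=> sz_v; apply: (@eq_from_nth _ false); rewrite size_charvec // => i lt_i.
by rewrite (nth_charvec _ (Ordinal lt_i)) mem_block.
Qed.

Lemma count_card v : size v = n -> count id v = #|[set i : 'I_n | nth false v i]|.
Proof.
move=> sz_v; rewrite cardE /enum_mem size_filter -enumT -{1}(blockK sz_v).
by rewrite count_map; apply: eq_count => i /=; rewrite mem_block inE.
Qed.

Lemma card_block v : size v = n -> #|block f v| = count id v.
Proof. by move=> sz_v; rewrite card_imset // count_card. Qed.

(** The conditions are one-sided: marked triples must be covered by [R], but not conversely. The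
    factor [i != j] makes [need] vanish on the diagonal, so that the sum in [mk_row] counts other
    points only. *)
Record entry_models R i j e : Prop := EntryModels {
  em_size : size (uncov e) = n;
  em_uncov : forall l, nth false (uncov e) l -> uniq [:: i; j; l]
    /\ exists2 b, b \in R & [&& f i \in b, f j \in b & f l \in b];
  em_need : need e <= (i != j) * thru R (f i) (f j);
  em_room : thru R (f i) (f j) <= room e
}.

Record row_models R i r : Prop := RowModels {
  rm_size : size (entries r) = n;
  rm_need : pneed r <= thru R (f i) (f i);
  rm_room : thru R (f i) (f i) <= proom r;
  rm_entry : forall j, entry_models R i j (nth entry0 (entries r) j)
}.

(** [R] stands for the blocks of an actual block set that the search has still to find. *)
Record models R (st : state) : Prop := Models {
  m_unif : forall b, b \in R -> #|b| = k;
  m_card : #|R| <= st.1;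
  m_size : size st.2 = n;
  m_row : forall i, row_models R i (nth row0 st.2 i)
}.

Hypothesis k_ge3 : 2 < k.

Lemma mk_entry_models R i j m r : (forall b, b \in R -> #|b| = k) ->
    size m = n ->
    (forall l, nth false m l -> uniq [:: i; j; l]
      /\ exists2 b, b \in R & [&& f i \in b, f j \in b & f l \in b]) ->
    thru R (f i) (f j) <= r ->
  entry_models R i j (mk_entry k m r).
Proof.
move=> unifR sz_m mP le_r; split=> //=.
apply: chunks_le; first by rewrite subn_gt0.
rewrite add0n count_card // -(card_imset _ f_inj).
(* On the diagonal the distinctness in [mP] leaves no marked point at all. *)
case: (eqVneq i j) mP => [<- mP|neq_ij mP] /=.
  rewrite mul0n muln0 leqn0 cards_eq0 -subset0.
  by apply/subsetP=> x /imsetP[l]; rewrite inE => /mP[] /=; rewrite inE eqxx.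
rewrite mul1n; apply: leq_thru_cover => //; first by rewrite (inj_eq f_inj).
  apply/subsetP=> x /imsetP[l]; rewrite inE => /mP[+ _] -> /=.
  rewrite /= !inE andbT !negb_or !(inj_eq f_inj) ![l == _]eq_sym.
  by case/andP=> /andP[_ ->] ->.
by move=> x /imsetP[l]; rewrite inE => /mP[_ +] ->.
Qed.

(** The codegrees of a point with the others add up to [k - 1] times its degree, so lower bounds for
    them yield one for the degree. *)
Lemma mk_row_models R i r es : (forall b, b \in R -> #|b| = k) ->
    size es = n -> thru R (f i) (f i) <= r ->
    (forall j, entry_models R i j (nth entry0 es j)) ->
  row_models R i (mk_row k r es).
Proof.
move=> unifR sz_es le_r esP; split=> //=.
have k1_gt0 : 0 < k - 1 by rewrite subn_gt0 ltnW.
have Dk : k - 1 = (k - 2).+1 by rewrite -subSn ?subSS // ltnW.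
rewrite -ltnS ltn_divLR // mulSn {1}Dk addSn ltnS [leqRHS]addnC leq_add2r.
rewrite mulnC -(sum_thru_neq unifR) sumnE big_map (big_nth entry0) sz_es big_mkord.
rewrite (reindex f) /=; last exact: onW_bij.
rewrite [leqRHS]big_mkcond; apply: leq_sum => j _.
rewrite (inj_eq f_inj); apply: leq_trans (em_need (esP j)) _.
by case: ifP; rewrite ?mul1n.
Qed.

Lemma init_models R r (cap : nat -> nat -> nat)
      (tgt : nat -> nat -> nat -> bool) :
    (forall b, b \in R -> #|b| = k) ->
    #|R| <= r -> (forall i j, thru R (f i) (f j) <= cap i j) ->
    (forall i j l : 'I_n, tgt i j l -> uniq [:: i; j; l]
      /\ exists2 b, b \in R & [&& f i \in b, f j \in b & f l \in b]) ->
  models R (init n k r cap tgt).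
Proof.
move=> unifR cardR capR tgtR; split=> //=; rewrite ?size_mkseq // => i.
rewrite nth_mkseq //; apply: mk_row_models; rewrite ?size_mkseq // => j.
rewrite nth_mkseq //; apply: mk_entry_models; rewrite ?size_mkseq // => l.
by rewrite nth_mkseq //; exact: tgtR.
Qed.

Lemma thruD1 R b x y : b \in R ->
  thru R x y = ((x \in b) && (y \in b)) + thru (R :\ b) x y.
Proof. by move=> Rb; rewrite !thruE (big_setD1 b). Qed.

Lemma add_block_models R st v : size v = n -> block f v \in R ->
  models R st -> models (R :\ block f v) (add_block k v st).
Proof.
move=> sz_v Rv [unifR cardR sz_st rows]; set R' := R :\ _.
have unifR' b : b \in R' -> #|b| = k by case/setD1P=> _ /unifR.
have thruR' i j : thru R (f i) (f j)
    = (nth false v i && nth false v j) + thru R' (f i) (f j).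
  by rewrite (thruD1 _ _ Rv) !mem_block.
have le_pred m p : true + m <= p -> m <= p.-1 by case: p.
split=> //=; rewrite ?size_on_support //.
  by rewrite (cardsD1 (block f v)) Rv in cardR; exact: le_pred.
move=> i; rewrite nth_on_support ?sz_st //.
case: (rows i) => sz_es needi roomi es; rewrite thruR' andbb in roomi.
case: ifP => vi; rewrite vi in roomi.
  apply: mk_row_models => //; rewrite ?size_on_support //.
    exact: le_pred.
  move=> j; rewrite nth_on_support ?sz_es //.
  case: (es j) => sz_e covj needj roomj; rewrite thruR' vi in roomj.
  case: ifP => vj; rewrite vj in roomj.
    apply: mk_entry_models; rewrite ?size_on_support //.
      move=> l; rewrite nth_on_support ?sz_e //.
      (* A triple with a point outside the new block is covered by another block, which survives in
         [R']. *)
      case: ifP => // vl /covj[-> [b Rb bP]]; split=> //; exists b => //; rewrite !inE Rb andbT.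
      by apply: contraFneq vl => Db; move: bP; rewrite Db !mem_block => /and3P[].
    exact: le_pred.
  split=> //; last by rewrite thruR' vi vj in needj.
  move=> l /covj[-> [b Rb bP]]; split=> //; exists b => //; rewrite !inE Rb andbT.
  by apply: contraFneq vj => Db; move: bP; rewrite Db !mem_block => /and3P[].
split=> //; first by rewrite thruR' vi in needi.
move=> j; case: (es j) => sz_e covj needj roomj; rewrite thruR' vi in needj roomj.
split=> // l /covj[-> [b Rb bP]]; split=> //; exists b => //; rewrite !inE Rb andbT.
by apply: contraFneq vi => Db; move: bP; rewrite Db !mem_block => /and3P[].
Qed.

(** The true degrees and codegrees lie between the bounds compared, and the degrees add up to [k]
    times the number of blocks. *)
Lemma feasible_models R st v : models R st -> feasible k v st.
Proof.
case=> unifR cardR sz_st rows; apply/andP; split.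
  apply: (all_mask_nth (x0 := row0)) => i; rewrite sz_st => lt_i _.
  case: (rows (Ordinal lt_i)) => /= sz_es needi roomi es.
  rewrite (leq_trans needi) //=; apply: (all_mask_nth (x0 := entry0)) => j.
  rewrite sz_es => lt_j _; case: (es (Ordinal lt_j)) => /= _ _ needj.
  by apply: leq_trans; apply: leq_trans needj _; case: (_ != _); rewrite ?mul1n.
apply: leq_trans (leq_mul (leqnn k) cardR); rewrite -(sum_deg unifR).
rewrite sumnE big_map (big_nth row0) sz_st big_mkord.
rewrite (reindex f) /=; last exact: onW_bij.
by apply: leq_sum => i _; case: (rows i).
Qed.

Lemma admissible_models R st v : block f v \in R -> models R st ->
  admissible v st.
Proof.
move=> Rv [_ _ sz_st rows].
apply: (all_mask_nth (x0 := row0)) => i; rewrite sz_st => lt_i vi.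
case: (rows (Ordinal lt_i)) => /= sz_es _ _ es.
apply: (all_mask_nth (x0 := entry0)) => j; rewrite sz_es => lt_j vj.
case: (es (Ordinal lt_j)) => /= _ _ _; apply: leq_trans.
by apply/card_gt0P; exists (block f v); rewrite inE Rv !mem_block vi.
Qed.

Definition holds (L : seq (seq bool)) R := all (fun v => block f v \in R) L.

(** [R] is what remains of [R0]. Some block of [R] covers the chosen triple; the branch adding this
    block passes every test, and the induction continues without it. *)
Lemma search_models fuel R R0 st acc : models R st -> R \subset R0 ->
  holds acc R0 -> exists2 l, l \in search n k fuel st acc & holds l R0.
Proof.
elim: fuel R st acc => [|m IHm] R st acc mR sRR0 accR0.
  by exists acc; rewrite ?inE.
rewrite [search _ _ _ _ _]/=.
case pickE: (pick_triple _ _) => [[[x y] z]|]; last first.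
  by exists acc; rewrite ?inE.
have [unifR _ sz_st rows] := mR.
case/pick_tripleP: pickE; rewrite sz_st => ltx.
case: (rows (Ordinal ltx)) => /= sz_es _ _ es; rewrite sz_es => lty.
case: (es (Ordinal lty)) => /= sz_e covP _ _ uz.
have ltz : z < n.
  by rewrite ltnNge -sz_e; apply: contraL uz => /(nth_default false) ->.
have [Uxyz [b Rb bxyz]] := covP (Ordinal ltz) uz.
set v := charvec f b; have sz_v : size v = n := size_charvec b.
have Rv : block f v \in R by rewrite charvecK.
have mR' := add_block_models sz_v Rv mR.
have accR0' : holds (v :: acc) R0 by rewrite /= (subsetP sRR0).
have [|l sl lR0] := IHm _ _ _ mR' _ accR0'.
  exact: subset_trans (subD1set _ _) sRR0.
exists l => //; apply/flattenP.
exists (search n k m (add_block k v st) (v :: acc)) => //.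
apply/mapP; exists v; last by rewrite /= (feasible_models _ mR').
rewrite mem_filter (admissible_models Rv mR) /=; apply: mem_supersets.
- by rewrite sz_v size_indicator.
- move=> t; rewrite nth_indicator => /andP[ltt].
  rewrite (nth_charvec b (Ordinal ltt)) !inE; case/and3P: bxyz => bx b_y bz.
  have eq_t s (lti : s < n) :
      f (Ordinal lti) \in b -> t = s -> f (Ordinal ltt) \in b.
    by move=> bi Et; rewrite (_ : Ordinal ltt = Ordinal lti) //; apply: val_inj.
  by case/or3P=> /eqP; [exact: eq_t bx|exact: eq_t b_y|exact: eq_t bz].
rewrite count_indicator /= ?ltx ?lty ?ltz //.
by rewrite -(card_block sz_v) charvecK (unifR b Rb) subnKC.
Qed.

Definition start k st S := foldl (fun st v => add_block k v st) st S.

(** Distinct vectors of length [n] give distinct blocks, so removing one prescribed block leaves the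
    later ones in [R]. *)
Lemma start_models R st (S : seq (seq bool)) :
    uniq S -> all (fun v => size v == n) S ->
    holds S R -> models R st ->
  exists2 R' : {set {set X}}, R' \subset R & models R' (start k st S).
Proof.
elim: S R st => [|v S IHS] R st /=; first by exists R.
case/andP=> vS US /andP[/eqP sz_v sz_S] /andP[Rv RS] mR.
have [//|//||R' sR' mR'] := IHS _ _ _ _ _ (add_block_models sz_v Rv mR).
  apply/allP=> w Sw; rewrite !inE (allP RS) // andbT.
  apply: contraNneq vS => /(congr1 (charvec f)).
  by rewrite !blockK ?(eqP (allP sz_S w Sw)) // => <-.
by exists R' => //; exact: subset_trans sR' (subD1set _ _).
Qed.

End Models.

(** * Relabelling *)

(** When [s] is the one-line form of a permutation, this is the preimage of the set [v] under it. *)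
Definition pull (s : seq nat) (v : seq bool) := [seq nth false v j | j <- s].

(* A pair of cells (A, B) holds the blocks of the source and of the target with
   the same trace on the points already matched; a bijection extending the
   matching must map A onto B. *)
Definition cells := seq (seq (seq bool) * seq (seq bool)).

Definition split_cells (x y : nat) (cs : cells) : cells :=
  [seq c <- flatten
      [seq [:: ([seq v <- c.1 | nth false v x], [seq w <- c.2 | nth false w y]);
               ([seq v <- c.1 | ~~ nth false v x],
                [seq w <- c.2 | ~~ nth false w y])] | c <- cs]
   | c != ([::], [::])].

Definition balanced (cs : cells) := all (fun c => size c.1 == size c.2) cs.

(** Entry i of [s] is the source point matched with target point i. Leaves are not tested: the
    balance condition is only necessary. *)
Fixpoint embeddings n m (cs : cells) (s : seq nat) : seq (seq nat) :=
  if m is m'.+1 then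
    flatten [seq let cs' := split_cells j (size s) cs in
                 if balanced cs' then embeddings n m' cs' (rcons s j) else [::]
               | j <- iota 0 n & j \notin s]
  else [:: s].

(** Tested from scratch on complete matchings, so that the results of [embeds] are right whatever
    its pruning does. *)
Definition compatible n (col : nat -> nat) (D l : seq (seq bool)) s :=
  [&& perm_eq s (iota 0 n), map col s == map col (iota 0 n)
    & all (fun v => pull s v \in l) D].

(* The nested [if]s and [find ... < n] in place of [&&] and [has] keep the search
   short-circuiting: [vm_compute] evaluates both arguments of a boolean
   connective. *)
Fixpoint embeds n (col : nat -> nat) (D l : seq (seq bool)) m cs s :=
  if m is m'.+1 then
    find (fun j =>
      if (col j == col (size s)) && (j \notin s) then
        let cs' := split_cells j (size s) cs in
        if balanced cs' then embeds n col D l m' cs' (rcons s j) else false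
      else false) (iota 0 n) < n
  else compatible n col D l s.

Lemma embedsP n col D l m cs s : embeds n col D l m cs s ->
  exists s', compatible n col D l s'.
Proof.
elim: m cs s => [|m IHm] cs s /=; first by exists s.
rewrite -[X in _ < X](size_iota 0) -has_find => /hasP[j _].
by case: ifP => // _; case: ifP => // _; exact: IHm.
Qed.

(** Pruning loses no genuine embedding: it maps the first half of each cell onto the second, and
    splitting preserves this because bit [size s] of the image is bit [j] of the source. *)
Lemma mem_embeddings n m (cs : cells) s t : size t = m -> uniq (s ++ t) ->
    all (fun j => j < n) t ->
    (forall c, c \in cs -> perm_eq (map (pull (s ++ t)) c.1) c.2) ->
  s ++ t \in embeddings n m cs s.
Proof.
elim: m cs s t => [|m IHm] cs s [|j t] //=; first by rewrite cats0 inE.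
case=> sz_t; rewrite -cat_rcons => Ust /andP[ltj ltt] csP.
have split_csP c : c \in split_cells j (size s) cs ->
    perm_eq (map (pull (rcons s j ++ t)) c.1) c.2.
  have nth_pull v : nth false (pull (rcons s j ++ t) v) (size s) = nth false v j.
    by rewrite cat_rcons /pull map_cat nth_cat size_map ltnn subnn.
  rewrite mem_filter => /andP[_ /flattenP[cs' /mapP[d /csP dP ->]]].
  have filterP (h : bool -> bool) :
      perm_eq (map (pull (rcons s j ++ t)) [seq v <- d.1 | h (nth false v j)])
              [seq w <- d.2 | h (nth false w (size s))].
    rewrite (eq_filter (a2 := preim (pull (rcons s j ++ t))
      (fun w => h (nth false w (size s))))); first by rewrite -filter_map perm_filter.
    by move=> v /=; rewrite nth_pull.
  by rewrite !inE => /orP[] /eqP ->; [exact: (filterP id)|exact: (filterP negb)].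
apply/flattenP; exists (embeddings n m (split_cells j (size s) cs) (rcons s j)).
  apply/mapP; exists j.
    rewrite mem_filter mem_iota ltj !andbT.
    by move: Ust; rewrite cat_uniq rcons_uniq => /andP[/andP[]].
  case: ifP => // /negP[]; apply/allP=> c /split_csP/perm_size.
  by rewrite size_map => ->.
exact: IHm.
Qed.

Section Relabelling.

Variables (X : finType) (n k : nat) (f : 'I_n -> X).
Hypotheses (cardX : #|X| = n) (f_inj : injective f).

Lemma perm_of_seq s : perm_eq s (iota 0 n) ->
  exists p : {perm 'I_n}, forall i, p i = nth 0 s i :> nat.
Proof.
move=> s_iota; have sz_s : size s = n by rewrite (perm_size s_iota) size_iota.
have lt_s (i : 'I_n) : nth 0 s i < n.
  have := mem_nth 0 (s := s) (n := i); rewrite (perm_mem s_iota) mem_iota sz_s.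
  by move/(_ (ltn_ord i)).
have inj_s : injective (fun i => Ordinal (lt_s i)).
  move=> i j /(congr1 val)/= /eqP; rewrite nth_uniq ?sz_s //.
    by move/eqP/val_inj.
  by rewrite (perm_uniq s_iota) iota_uniq.
by exists (perm inj_s) => i; rewrite permE.
Qed.

Lemma block_pull (p : {perm 'I_n}) s v : size s = n ->
    (forall i, p i = nth 0 s i :> nat) ->
  block f (pull s v) = block (f \o (p^-1)%g) v.
Proof.
move=> sz_s ps; apply/setP=> x; apply/imsetP/imsetP=> -[i]; rewrite inE => vi ->.
  exists (p i); last by rewrite /= permK.
  by rewrite inE ps; rewrite (nth_map 0) ?sz_s in vi.
exists ((p^-1)%g i) => //; rewrite inE (nth_map 0) ?sz_s //.
by rewrite -ps permKV.
Qed.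

Hypothesis k_ge3 : 2 < k.

(** One of the lists found lies inside [R], and it contains a relabelled representative; the
    relabelling is absorbed into [f]. *)
Lemma search_reps R st (S : seq (seq bool)) fuel col reps :
    models k f R st -> uniq S -> all (fun v => size v == n) S -> holds f S R ->
    all (fun l => has (fun D => embeds n col D l n [:: (D, l)] [::]) reps)
        (search n k fuel (start k st S) S) ->
  exists p : {perm 'I_n}, exists2 D, D \in reps
    & (forall i, col (p i) = col i) /\ holds (f \o (p^-1)%g) D R.
Proof.
move=> mR US szS SR /allP all_reps.
have [R' sR'R mR'] := start_models cardX f_inj k_ge3 US szS SR mR.
have [l /all_reps/hasP[D repD emb] lR] :=
  search_models cardX f_inj k_ge3 fuel mR' sR'R SR.
have [s /and3P[s_iota /eqP col_s /allP Dl]] := embedsP emb.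
have [p ps] := perm_of_seq s_iota.
have sz_s : size s = n by rewrite (perm_size s_iota) size_iota.
exists p; exists D => //; split=> [i|].
  have := congr1 (nth 0 ^~ i) col_s.
  by rewrite ps !(nth_map 0) ?size_iota ?sz_s // nth_iota.
by apply/allP=> v /Dl vl; rewrite -(block_pull _ sz_s ps) (allP lR).
Qed.

Definition design (L : seq (seq bool)) : {set {set X}} :=
  [set b | charvec f b \in L].

Lemma mem_design L v : size v = n -> (block f v \in design L) = (v \in L).
Proof. by move=> sz_v; rewrite inE blockK. Qed.

Lemma card_design L : uniq L -> all (fun v => size v == n) L ->
  #|design L| = size L.
Proof.
move=> UL /allP szL; rewrite -(size_map (block f)) -(card_uniqP _); last first.
  rewrite map_inj_in_uniq // => v w /szL/eqP sz_v /szL/eqP sz_w.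
  by move/(congr1 (charvec f)); rewrite !blockK.
apply: eq_card => b; rewrite inE; apply/idP/mapP=> [Lb|[v Lv ->]].
  by exists (charvec f b); rewrite ?charvecK.
by rewrite blockK //; exact/eqP/szL.
Qed.

Lemma holds_design L B : uniq L -> all (fun v => size v == n) L ->
  holds f L B -> #|B| <= size L -> B = design L.
Proof.
move=> UL szL /allP LB leBL; apply/esym/eqP; rewrite eqEcard card_design // leBL.
rewrite andbT; apply/subsetP=> b; rewrite inE => /LB.
by rewrite charvecK.
Qed.

End Relabelling.

(** * Automorphisms *)

Section Automorphisms.

Variables (X : finType) (n : nat) (f : 'I_n -> X).
Hypotheses (cardX : #|X| = n) (f_inj : injective f).

Implicit Types (s : {perm X}) (L : seq (seq bool)) (B : {set {set X}}).

Lemma set_actE (b : {set X}) s : ('P^* b s)%act = s @: b.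
Proof. by []. Qed.

Lemma design_act L s : design (s \o f) L = ('P^*^*%act (design f L) s).
Proof.
apply/setP=> b; apply/idP/imsetP=> [|[c]]; rewrite !inE.
  move=> Lb; exists (s @^-1: b).
    rewrite inE; congr (_ \in L): Lb.
    by apply: eq_map => i; rewrite inE.
  rewrite set_actE; apply/esym/setP=> x; rewrite -[x](permKV s).
  by rewrite mem_imset ?inE //; exact: perm_inj.
move=> Lc ->; congr (_ \in L): Lc.
by apply: eq_map => i /=; rewrite set_actE mem_imset //; exact: perm_inj.
Qed.

(** Two labellings differ by the permutation [f' \o g] of the points, where [g] inverts [f]. *)
Lemma design_orbit (f' : 'I_n -> X) L : injective f' ->
  design f' L \in orbit ('P^*^*)%act [set: {perm X}] (design f L).
Proof.
move=> f'_inj; have [g fK gK] : bijective f.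
  by apply: inj_card_bij; rewrite ?cardX ?card_ord.
have s_inj : injective (f' \o g) by apply: inj_comp f'_inj (can_inj gK).
apply/orbitP; exists (perm s_inj); first by rewrite inE.
rewrite -design_act; apply/setP=> b; rewrite !inE; congr (_ \in L).
by apply: eq_map => i; rewrite /= permE /= fK.
Qed.

(** Automorphisms correspond to members of [E]: each one is found because pruning is complete, and
    each member of [E] has been checked to be one. *)
Lemma card_aut L : uniq L -> all (fun v => size v == n) L ->
    let E := embeddings n n [:: (L, L)] [::] in
    uniq E -> all (compatible n (fun=> 0) L L) E ->
  #|covering_aut (design f L)| = size E.
Proof.
move=> UL /allP szL E UE /allP compatE.
have [g fK gK] : bijective f by apply: inj_card_bij; rewrite ?cardX ?card_ord.
(* The inverse enters because a point lies in [s @: b] exactly when its preimage under [s] lies in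
   [b]. *)
pose q s i : 'I_n := g ((s^-1)%g (f i)).
pose seq_of s := [seq val (q s i) | i <- enum 'I_n].
have sz_seq s : size (seq_of s) = n by rewrite size_map size_enum_ord.
have nth_seq s (i : 'I_n) : nth 0 (seq_of s) i = q s i.
  by rewrite (nth_map i) ?size_enum_ord // nth_ord_enum.
have q_inj s : injective (q s).
  by move=> i j /(can_inj gK)/perm_inj/f_inj.
have seq_of_inj : injective seq_of.
  move=> s1 s2 /eq_in_map eq12; apply/invg_inj/permP=> x.
  have /val_inj/(can_inj gK) := eq12 (g x) (mem_enum _ _).
  by rewrite !gK.
have charvec_act s (b : {set X}) :
    charvec f (s @: b) = pull (seq_of s) (charvec f b).
  have sz_pull : size (pull (seq_of s) (charvec f b)) = n.
    by rewrite size_map sz_seq.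
  apply: (@eq_from_nth _ false); rewrite size_charvec ?sz_pull // => i lti.
  rewrite (nth_charvec _ _ (Ordinal lti)) (nth_map 0) ?sz_seq //.
  rewrite (nth_seq s (Ordinal lti)) nth_charvec gK -{1}[f _](permKV s).
  by rewrite mem_imset //; exact: perm_inj.
have autP s : reflect {in L, forall v, pull (seq_of s) v \in L}
                      (s \in covering_aut (design f L)).
  apply: (iffP astab1P) => [sB v Lv | sL].
    have sz_v := eqP (szL v Lv).
    rewrite -{1}(blockK f_inj sz_v) -charvec_act.
    have : s @: block f v \in design f L.
      by rewrite -sB; apply: imset_f; rewrite mem_design.
    by rewrite inE.
  apply/eqP; rewrite eqEcard card_imset ?leqnn ?andbT; last exact: act_inj.
  apply/subsetP=> b /imsetP[c]; rewrite inE => Lc ->.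
  by rewrite inE set_actE charvec_act; exact: sL.
have <- : size [seq seq_of s | s <- enum (covering_aut (design f L))] = size E.
  apply/perm_size/uniq_perm; rewrite ?(map_inj_uniq seq_of_inj) ?enum_uniq //.
  move=> t; apply/mapP/idP=> [[s] | Et].
    rewrite mem_enum => /autP sL ->.
    apply: (@mem_embeddings n n [:: (L, L)] [::]).
    - exact: sz_seq.
    - by rewrite map_inj_uniq ?enum_uniq // => i j /val_inj/q_inj.
    - by rewrite all_map; apply/allP=> i _ /=; exact: ltn_ord.
    move=> c; rewrite inE => /eqP -> /=.
    (* An injection of the finite list [L] into itself permutes it, as the cell invariant
       demands. *)
    have Us : uniq (map (pull (seq_of s)) L).
      rewrite map_inj_in_uniq // => v w /szL/eqP sz_v /szL/eqP sz_w.
      rewrite -(blockK f_inj sz_v) -(blockK f_inj sz_w) -!charvec_act.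
      by move/(congr1 (block f)); rewrite !charvecK // => /(imset_inj perm_inj) ->.
    have sub_L : {subset map (pull (seq_of s)) L <= L}.
      by move=> w /mapP[v /sL + ->].
    have [|_ eq_L] := uniq_min_size Us sub_L; first by rewrite size_map.
    exact: uniq_perm.
  have /and3P[t_iota _ /allP tL] := compatE t Et.
  have [p pt] := perm_of_seq t_iota.
  have sz_t : size t = n by rewrite (perm_size t_iota) size_iota.
  have h_inj : injective (fun x => f (p (g x))).
    by move=> x y /f_inj/perm_inj/(can_inj gK).
  have Dt : t = seq_of ((perm h_inj)^-1)%g.
    apply: (@eq_from_nth _ 0); rewrite sz_t ?sz_seq // => i lti.
    by rewrite (nth_seq _ (Ordinal lti)) /q invgK permE !fK (pt (Ordinal lti)).
  exists ((perm h_inj)^-1)%g => //; rewrite mem_enum; apply/autP => v.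
  by rewrite -Dt; exact: tL.
by rewrite size_map cardE.
Qed.

End Automorphisms.

(** * The computations *)

(* Point 0 has degree 9, so its codegrees add up to 36; each of the ten is at
   least 3, hence at least four are equal to 3, and 1, 2, 3, 4 are such points. *)
Definition col4 (x : nat) := if x is 0 then 0 else if x < 5 then 1 else 2.
Definition col1 (x : nat) := if x is 0 then 0 else 1.

(** The colours add up to 1 exactly for point 0 and one of 1, 2, 3, 4. The value 9 is the trivial
    cap by the number of blocks through 0. *)
Definition cap_der x y := if col4 x + col4 y == 1 then 3 else 9.
Definition cap_cov (x y : nat) := if x == y then 10 else 4.

Definition trip_cov (x y z : nat) := uniq [:: x; y; z].
Definition trip_der x y z := trip_cov x y z && (0 \in [:: x; y; z]).
Definition trip_pair x y z := trip_der x y z && (1 \in [:: x; y; z]).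

(* The blocks through 0 and 1, up to permutations that preserve {1, 2, 3, 4}. *)
Definition stars := map (map (indicator 11))
  [:: [:: [:: 0; 1; 2; 3; 4]; [:: 0; 1; 5; 6; 7]; [:: 0; 1; 8; 9; 10]];
      [:: [:: 0; 1; 2; 3; 5]; [:: 0; 1; 4; 6; 7]; [:: 0; 1; 8; 9; 10]];
      [:: [:: 0; 1; 2; 5; 6]; [:: 0; 1; 3; 7; 8]; [:: 0; 1; 4; 9; 10]]].

(** The four derived designs, with point 0 restored to every quadruple. *)
Definition derived_reps := map (map (fun b => indicator 11 (0 :: b)))
  [:: [:: [:: 1; 2; 3; 4]; [:: 1; 5; 6; 7]; [:: 1; 8; 9; 10];
          [:: 2; 3; 5; 6]; [:: 2; 3; 7; 8]; [:: 2; 3; 9; 10];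
          [:: 4; 5; 6; 8]; [:: 4; 7; 9; 10]; [:: 5; 6; 9; 10]];
      [:: [:: 1; 2; 3; 4]; [:: 1; 5; 6; 7]; [:: 1; 8; 9; 10];
          [:: 2; 3; 5; 6]; [:: 2; 3; 7; 8]; [:: 2; 5; 9; 10];
          [:: 3; 6; 9; 10]; [:: 4; 5; 6; 8]; [:: 4; 7; 9; 10]];
      [:: [:: 1; 2; 3; 4]; [:: 1; 5; 6; 7]; [:: 1; 8; 9; 10];
          [:: 2; 3; 5; 8]; [:: 2; 3; 6; 9]; [:: 2; 3; 7; 10];
          [:: 4; 5; 6; 10]; [:: 4; 5; 7; 9]; [:: 4; 6; 7; 8]];
      [:: [:: 1; 2; 3; 4]; [:: 1; 5; 6; 7]; [:: 1; 8; 9; 10];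
          [:: 2; 3; 5; 8]; [:: 2; 3; 6; 9]; [:: 2; 5; 7; 10];
          [:: 3; 7; 8; 10]; [:: 4; 5; 7; 9]; [:: 4; 6; 8; 10]]].

(* oo is 0, and (0,i), (1,i) are i + 1, i + 6. *)
Definition cov20 :=
  [seq indicator 11 [:: 0; i + 1; j + 1; i + 6; j + 6]
    | i <- iota 0 5, j <- iota 0 i]
  ++ [seq indicator 11 (i + 1 :: [seq j + 6 | j <- iota 0 5 & j != i])
       | i <- iota 0 5]
  ++ [seq indicator 11 (i + 6 :: [seq j + 1 | j <- iota 0 5 & j != i])
       | i <- iota 0 5].

Definition reduces col st S reps :=
  all (fun l => has (fun D => embeds 11 col D l 11 [:: (D, l)] [::]) reps)
      (search 11 5 20 (start 5 st S) S).

(** Three blocks through 0 and 1 cut the other nine points into triples; the representatives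
    distribute 2, 3, 4 among them as 3, 2+1 and 1+1+1. *)
Lemma stars_exhaustive :
  reduces col4 (init 11 5 3 cap_der trip_pair) [::] stars.
Proof. by vm_cast_no_check (erefl true). Qed.

(** Each star is extended to all blocks through 0; the final relabelling has to fix only the point
    0. *)
Lemma derived_exhaustive :
  all (fun S => reduces col1 (init 11 5 9 cap_der trip_der) S derived_reps) stars.
Proof. by vm_cast_no_check (erefl true). Qed.

(** A derived design without extension passes vacuously, its search returning no list. *)
Lemma cov20_exhaustive :
  all (fun S => reduces (fun=> 0) (init 11 5 20 cap_cov trip_cov) S [:: cov20])
      derived_reps.
Proof. by vm_cast_no_check (erefl true). Qed.

Lemma stars_wf : all (fun S => uniq S && all (fun v => size v == 11) S) stars.
Proof. by vm_compute. Qed.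

Lemma derived_wf :
  all (fun D => [&& uniq D, all (fun v => size v == 11) D, size D == 9
    & all (fun y => count (fun v => nth false v y) D <= 4) (iota 1 10)])
  derived_reps.
Proof. by vm_compute. Qed.

Lemma cov20_wf :
  [&& uniq cov20, all (fun v => size v == 11) cov20, size cov20 == 20
    & all (fun v => count id v == 5) cov20].
Proof. by vm_compute. Qed.

Lemma cov20_covers :
  all (fun x => all (fun y => all (fun z =>
    has (fun v => [&& nth false v x, nth false v y & nth false v z]) cov20)
  (iota 0 11)) (iota 0 11)) (iota 0 11).
Proof. by vm_compute. Qed.

Definition cov20_auts := embeddings 11 11 [:: (cov20, cov20)] [::].

Lemma cov20_autsP : [&& size cov20_auts == 240, uniq cov20_auts
  & all (compatible 11 (fun=> 0) cov20 cov20) cov20_auts].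
Proof. by vm_cast_no_check (erefl true). Qed.

(** * Coverings with 20 blocks *)

Section Coverings.

Variable X : finType.
Hypothesis cardX : #|X| = 11.

Lemma design_cov20 (f : 'I_11 -> X) : injective f ->
  design f cov20 \in coverings X 3 11 5 20.
Proof.
move=> f_inj; have [g fK gK] : bijective f.
  by apply: inj_card_bij; rewrite ?cardX ?card_ord.
have /and4P[U20 sz20 /eqP len20 /allP k20] := cov20_wf.
rewrite inE card_design // len20 eqxx andbT /is_covering cardX eqxx /=.
apply/andP; split; apply/forallP.
  move=> b; apply/implyP; rewrite inE => Lb; rewrite -(charvecK cardX f_inj b).
  by rewrite card_block ?k20 ?size_charvec.
move=> T; apply/implyP; rewrite cardE; case ET: (enum T) => [|x [|y [|z []]]] // _.
have -> : T = [set x; y; z].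
  by apply/setP=> t; rewrite -mem_enum ET !inE orbA.
have in11 (i : 'I_11) : val i \in iota 0 11 by rewrite mem_iota ltn_ord.
have /allP/(_ _ (in11 (g x)))/allP/(_ _ (in11 (g y)))/allP/(_ _ (in11 (g z))) :=
  cov20_covers.
case/hasP=> v v20 /and3P[vx vy vz]; apply/existsP; exists (block f v).
rewrite mem_design ?(eqP (allP sz20 v v20)) // v20 /=.
by rewrite !subUset !sub1set -[x]gK -[y]gK -[z]gK !mem_block // vx vy.
Qed.

Variable B : {set {set X}}.
Hypothesis covB : B \in coverings X 3 11 5 20.

Let cardB : #|B| = 20.
Proof. by move: covB; rewrite inE => /andP[_ /eqP]. Qed.

Let unifB b : b \in B -> #|b| = 5.
Proof.
move=> Bb; move: covB; rewrite inE => /andP[/and3P[_ /forallP/(_ b)]].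
by rewrite Bb => /eqP.
Qed.

Let covers x y z : uniq [:: x; y; z] ->
  exists2 b, b \in B & [&& x \in b, y \in b & z \in b].
Proof.
move/card_uniqP => card_xyz.
move: covB; rewrite inE.
case/andP=> /and3P[_ _ /forallP/(_ [set x; y; z])/implyP covT] _.
have /covT/existsP[b /andP[Bb]] : #|[set x; y; z]| == 3.
  by rewrite -[3]card_xyz; apply/eqP/eq_card => t; rewrite !inE orbA.
rewrite !subUset !sub1set => /andP[/andP[bx b_y] bz].
by exists b => //; rewrite bx b_y.
Qed.

(** Nine other points must be covered, three by each block through the pair. *)
Lemma thru_ge3 x y : x != y -> 3 <= thru B x y.
Proof.
move=> neq_xy; rewrite -(leq_pmul2l (m := 3)) // -[3 * 3]/9.
have <- : #|~: [set x; y]| = 9 by rewrite cardsCs setCK cardX cards2 neq_xy.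
apply: (leq_thru_cover unifB) => // z; rewrite !inE negb_or => /andP[neq_zx neq_zy].
by apply: covers; rewrite /= !inE andbT negb_or neq_xy ![_ == z]eq_sym neq_zx neq_zy.
Qed.

Lemma labelling x0 : thru B x0 x0 <= 9 ->
  exists f : 'I_11 -> X, [/\ injective f, f ord0 = x0
    & forall i : 'I_11, 0 < i < 5 -> thru B x0 (f i) <= 3].
Proof.
move=> deg_x0; pose H := [set y | (y != x0) && (thru B x0 y <= 3)].
have H_ge4 : 4 <= #|H|.
  (* Codegrees are at least 3, and those equal to 3 gain 1 from [H]. Summing over ten points gives
     40 <= 36 + #|H|. *)
  have : \sum_(y | x0 != y) 4 <= \sum_(y | x0 != y) (thru B x0 y + (y \in H)).
    apply: leq_sum => y neq_y; rewrite inE eq_sym neq_y /=.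
    case: (leqP (thru B x0 y) 3) => [_|gt3]; last by rewrite addn0.
    by rewrite addn1 ltnS thru_ge3.
  rewrite sum_nat_const big_split /= (sum_thru_neq unifB) -/thru.
  have -> : #|[pred y | x0 != y]| = 10.
    have := cardC (pred1 x0); rewrite card1 cardX => -[<-].
    by apply: eq_card => y; rewrite !inE eq_sym.
  have -> : \sum_(y | x0 != y) (y \in H) = #|H|.
    rewrite -sum1_card big_mkcond [RHS]big_mkcond; apply: eq_bigr => y _.
    by rewrite inE eq_sym; case: eqP; case: leq.
  move=> le40; rewrite -(leq_add2l 36); apply: leq_trans le40 _.
  by rewrite leq_add2r -[36]/(4 * 9) leq_mul2l.
(* Listing [H] right after [x0] gives the labels 1 to 4 to points of codegree at most 3. *)
pose s := x0 :: enum H ++ enum (~: (x0 |: H)).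
have x0H : x0 \notin H by rewrite inE eqxx.
have Us : uniq s.
  rewrite /= cat_uniq !enum_uniq mem_cat !mem_enum negb_or x0H !inE eqxx /= andbT.
  by apply/hasPn=> y; rewrite !mem_enum !inE negb_or => /andP[].
have sz_s : size s = 11.
  rewrite -(card_uniqP Us) -cardX; apply: eq_card => y.
  rewrite in_cons mem_cat !mem_enum in_setC in_setU1.
  by case: (y == x0); case: (y \in H).
exists (fun i => nth x0 s i); split=> // [i j /eqP|i /andP[i_gt0 i_lt5]].
  by rewrite nth_uniq ?sz_s // => /eqP/val_inj.
case: i i_gt0 i_lt5 => [[|i] lti] //= _; rewrite ltnS => lti4.
have ltiH := leq_trans lti4 H_ge4; rewrite nth_cat -cardE ltiH.
have : nth x0 (enum H) i \in H by rewrite -mem_enum mem_nth // -cardE.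
by rewrite inE => /andP[].
Qed.

(** Two searches in turn: the blocks through [x0] and the point labelled 1 are brought to a star,
    and from this star all blocks through [x0] are found. *)
Lemma derived_classification x0 : thru B x0 x0 <= 9 ->
  exists f : 'I_11 -> X, [/\ injective f, f ord0 = x0
    & exists2 D, D \in derived_reps & holds f D [set b in B | x0 \in b]].
Proof.
move=> deg_x0; have [f [f_inj f0 codeg_f]] := labelling deg_x0.
set R0 := [set b in B | x0 \in b]; pose R1 := [set b in R0 | f (inord 1) \in b].
have sR0 : R0 \subset B by apply/subsetP=> b; rewrite inE => /andP[].
have cardR0 : #|R0| <= 9.
  apply: leq_trans deg_x0; apply/subset_leq_card/subsetP=> b.
  by rewrite !inE => /andP[-> ->].
have le_cap (h : 'I_11 -> X) : h ord0 = x0 ->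
    (forall i : 'I_11, 0 < i < 5 -> thru B x0 (h i) <= 3) ->
  forall i j : 'I_11, thru R0 (h i) (h j) <= cap_der i j.
  move=> h0 codeg_h i j; rewrite /cap_der; case: ifP => [|_]; last first.
    apply: leq_trans cardR0; apply/subset_leq_card/subsetP=> b.
    by rewrite inE => /andP[].
  (* By symmetry the point of colour 0, which is point 0 itself, may be taken first. *)
  wlog: i j / col4 i = 0 => [IH|i0].
    case Di: (col4 i) => [|[|c]] // Dj; first by apply: IH; rewrite ?Di.
    rewrite thruC; apply: IH; first by move: Dj; case: (col4 j).
    by rewrite addnC Di.
  rewrite i0 add0n => /eqP Dj; have -> : i = ord0.
    by apply: val_inj => /=; move: i0; case: (val i) => //= m; case: ifP.
  rewrite h0; apply: leq_trans (thru_sub _ _ sR0) (codeg_h j _).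
  by move: Dj; case: (val j) => //= m; case: ifP.
have covR0 (h : 'I_11 -> X) : h ord0 = x0 -> injective h ->
    forall i j l : 'I_11, trip_der i j l -> uniq [:: i; j; l]
    /\ exists2 b, b \in R0 & [&& h i \in b, h j \in b & h l \in b].
  move=> h0 h_inj i j l /andP[]; rewrite /trip_cov => Uijl mem0.
  have {}Uijl : uniq [:: i; j; l] by rewrite -(map_inj_uniq val_inj).
  split=> //; have [|b Bb bP] := covers (x := h i) (y := h j) (z := h l).
    by rewrite -[[:: h i; _; _]]/(map h [:: i; j; l]) map_inj_uniq.
  exists b => //; rewrite inE Bb -h0; case/and3P: bP => bi bj bl.
  move: mem0; rewrite !inE => /or3P[] /eqP/esym/(@val_inj _ _ _ _ ord0) <- //.
have unifR0 b : b \in R0 -> #|b| = 5 by move/(subsetP sR0)/unifB.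
have mod1 : models 5 f R1 (init 11 5 3 cap_der trip_pair).
  have sR1 : R1 \subset R0 by apply/subsetP=> b; rewrite inE => /andP[].
  apply: init_models => //.
  - by move=> b /(subsetP sR1)/unifR0.
  - have := le_cap f f0 codeg_f ord0 (inord 1); rewrite /cap_der inordK //= f0 => le3.
    apply: leq_trans le3; apply/subset_leq_card/subsetP=> b; rewrite !inE.
    by case/andP=> /andP[-> ->] ->.
  - by move=> i j; apply: leq_trans (thru_sub _ _ sR1) (le_cap f f0 codeg_f i j).
  move=> i j l /andP[/(covR0 f f0 f_inj)[Uijl [b R0b bP]] mem1].
  split=> //; exists b => //; rewrite inE R0b /=; case/and3P: bP => bi bj bl.
  have f1_in (t : 'I_11) : f t \in b -> 1 = t -> f (inord 1) \in b.
    by move=> bt D1; rewrite (_ : inord 1 = t) //; apply: val_inj; rewrite /= inordK.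
  move: mem1; rewrite !inE.
  by case/or3P=> /eqP; [exact: f1_in bi|exact: f1_in bj|exact: f1_in bl].
have [p [S repS [col_p SR1]]] :=
  search_reps cardX f_inj (isT : 2 < 5) mod1 (isT : uniq [::]) isT isT stars_exhaustive.
(* [p] preserves [col4], so the new labelling still sends 0 to [x0] and 1, ..., 4 to points of
   codegree at most 3. *)
pose h := f \o (p^-1)%g.
have h_inj : injective h by apply: inj_comp => //; exact: perm_inj.
have p0 : p ord0 = ord0.
  by apply: val_inj => /=; have := col_p ord0; case: (val (p _)) => //= m; case: ifP.
have h0 : h ord0 = x0 by rewrite /h /= -p0 permK.
have codeg_h (i : 'I_11) : 0 < i < 5 -> thru B x0 (h i) <= 3.
  move=> i_Z; apply: codeg_f; have := col_p ((p^-1)%g i); rewrite permKV.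
  by case: (val i) i_Z => // m /= ->; case: (val _) => //= m'; case: ifP.
have mod2 : models 5 h R0 (init 11 5 9 cap_der trip_der).
  by apply: init_models => //; [exact: le_cap|exact: covR0].
have /andP[US szS] := allP stars_wf S repS.
have SR0 : holds h S R0 by apply: sub_all SR1 => v; rewrite inE => /andP[].
have [q [D repD [col_q DR0]]] :=
  search_reps cardX h_inj (isT : 2 < 5) mod2 US szS SR0 (allP derived_exhaustive S repS).
exists (h \o (q^-1)%g); split.
- by apply: inj_comp => //; exact: perm_inj.
- have q0 : q ord0 = ord0.
    by apply: val_inj => /=; have := col_q ord0; case: (val (q _)).
  by rewrite /= -q0 permK.
by exists D.
Qed.

(** At most 9 blocks pass through [x0], and they include the 9 blocks of a representative; hence
    they are these, and the codegrees can be read off. *)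
Lemma derived_degrees x0 : thru B x0 x0 <= 9 ->
  thru B x0 x0 = 9 /\ forall y, x0 != y -> thru B x0 y <= 4.
Proof.
move=> deg_x0; have [f [f_inj f0 [D repD DR0]]] := derived_classification deg_x0.
set R0 := [set b in B | x0 \in b] in DR0.
have /and4P[UD szD /eqP lenD maxD] := allP derived_wf D repD.
have degE : #|R0| = thru B x0 x0 by apply: eq_card => b; rewrite !inE andbb.
have DR : R0 = design f D.
  by apply: holds_design; rewrite ?degE ?lenD.
split; first by rewrite -degE DR card_design.
move=> y neq_y; have [g fK gK] : bijective f.
  by apply: inj_card_bij; rewrite ?cardX ?card_ord.
have g_y : val (g y) \in iota 1 10.
  rewrite mem_iota ltn_ord andbT lt0n; apply: contraNneq neq_y => g0.
  by rewrite -f0 -[y]gK; apply/eqP; congr f; exact: val_inj.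
apply: leq_trans (allP maxD _ g_y); rewrite -size_filter -(card_design cardX f_inj).
- apply/subset_leq_card/subsetP=> b; rewrite inE => /and3P[Bb bx b_y].
  have: b \in R0 by rewrite inE Bb.
  by rewrite DR !inE mem_filter => ->; rewrite nth_charvec gK b_y.
- exact: filter_uniq.
by apply/allP=> v; rewrite mem_filter => /andP[_ /(allP szD)].
Qed.

(** A by-product of the classification: a degree of at most 9 is exactly 9. *)
Lemma deg_ge9 x : 9 <= thru B x x.
Proof. by case: (leqP (thru B x x) 9) => [/derived_degrees[->]|/ltnW]. Qed.

Lemma deg_sum : \sum_x thru B x x = 100.
Proof. by rewrite (sum_deg unifB) cardB. Qed.

(** The other ten points take at least 90 of the 100 incidences. *)
Lemma deg_le10 x : thru B x x <= 10.
Proof.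
rewrite -(leq_add2r 90) -[10 + 90]deg_sum (bigD1 x) //= leq_add2l.
have -> : 90 = \sum_(y | y != x) 9.
  rewrite sum_nat_const; have := cardC (pred1 x); rewrite card1 cardX.
  by rewrite addSn add0n => -[->].
by apply: leq_sum => y _; exact: deg_ge9.
Qed.

Lemma exists_deg9 : exists x, thru B x x <= 9.
Proof.
apply/existsP; apply: contraT; rewrite negb_exists => /forallP deg10.
have: \sum_(x : X) 10 <= 100.
  by rewrite -deg_sum; apply: leq_sum => x _; rewrite ltnNge.
by rewrite sum_nat_const cardX.
Qed.

(** If neither point has degree 9, the degrees add up to at least 10 + 10 + 9 * 9 = 101, one too
    many. *)
Lemma codeg_le4 x y : x != y -> thru B x y <= 4.
Proof.
move=> neq_xy; case: (leqP (thru B x x) 9) => [/derived_degrees[_ -> //]|deg_x].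
case: (leqP (thru B y y) 9) => [/derived_degrees[_ le4]|deg_y].
  by rewrite thruC le4 // eq_sym.
have: 100 < \sum_z thru B z z; last by rewrite deg_sum.
rewrite (bigD1 x) // (bigD1 y) 1?eq_sym //=.
have le81 : 81 <= \sum_(z | (z != x) && (z != y)) thru B z z.
  have c9 : #|~: [set x; y]| = 9 by rewrite cardsCs setCK cardX cards2 neq_xy.
  apply: (@leq_trans (\sum_(z in ~: [set x; y]) 9)).
    by rewrite sum_nat_const c9.
  rewrite (eq_bigl (fun z => (z != x) && (z != y))) => [|z].
    by apply: leq_sum => z _; exact: deg_ge9.
  by rewrite !inE negb_or.
by apply: leq_trans (leq_add deg_x (leq_add deg_y le81)).
Qed.

(** The search started from the derived design at a point of degree 9 puts a copy of [cov20] inside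
    [B], and both have 20 blocks. *)
Lemma covering_unique : exists f : 'I_11 -> X, injective f /\ B = design f cov20.
Proof.
have [x0 deg_x0] := exists_deg9.
have [f [f_inj f0 [D repD DR0]]] := derived_classification deg_x0.
have /and4P[UD szD _ _] := allP derived_wf D repD.
have DB : holds f D B by apply: sub_all DR0 => v; rewrite inE => /andP[].
have modB : models 5 f B (init 11 5 20 cap_cov trip_cov).
  apply: init_models => //= [|i j|i j l]; first by rewrite cardB.
    rewrite /cap_cov; case: eqP => [/val_inj ->|/eqP neq_ij]; first exact: deg_le10.
    by rewrite codeg_le4 // (inj_eq f_inj).
  rewrite /trip_cov => Uijl; have {}Uijl : uniq [:: i; j; l].
    by rewrite -(map_inj_uniq val_inj).
  split=> //; apply: covers.
  by rewrite -[[:: f i; _; _]]/(map f [:: i; j; l]) map_inj_uniq.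
have [p [L]] :=
  search_reps cardX f_inj (isT : 2 < 5) modB UD szD DB (allP cov20_exhaustive D repD).
rewrite inE => /eqP -> [_ LB].
have h_inj : injective (f \o (p^-1)%g) by apply: inj_comp => //; exact: perm_inj.
exists (f \o (p^-1)%g); split=> //.
have /and4P[U20 sz20 /eqP len20 _] := cov20_wf.
by apply: holds_design; rewrite ?len20 ?cardB.
Qed.

End Coverings.

(** * From uniqueness to the number of labelled coverings *)

Lemma card_permT (T : finType) : #|[set: {perm T}]| = #|T|`!.
Proof.
rewrite -cardsT -card_perm; apply: eq_card => s.
by rewrite !inE; apply/esym/subsetP.
Qed.

Lemma muln_pcancel a b c : 0 < c -> a * c = b * c -> a = b.
Proof. by move=> c_gt0 /eqP; rewrite eqn_pmul2r // => /eqP. Qed.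

(** Splitting off the factors 11 to 7 leaves 6! = 3 * 240, which spares a unary evaluation of
    11!. *)
Lemma fact11 : 11`! = 166320 * 240.
Proof.
have -> : 166320 = 11 * (10 * (9 * (8 * (7 * 3)))).
  by apply/eqP; vm_cast_no_check (erefl true).
by rewrite !factS -!mulnA.
Qed.

Theorem proposition15 (X : finType) (hX : #|X| = 11) :
  [/\ #|[set covering_class B | B in coverings X 3 11 5 20]| = 1,
      forall B : {set {set X}},
        B \in coverings X 3 11 5 20 -> #|covering_aut B| = 240
    & #|coverings X 3 11 5 20| = 166320].
Proof.
have /and4P[U20 sz20 _ _] := cov20_wf.
have /and3P[/eqP size_auts U_auts auts_ok] := cov20_autsP.
have aut240 (B : {set {set X}}) :
    B \in coverings X 3 11 5 20 -> #|covering_aut B| = 240.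
  move=> covB; have [f [f_inj ->]] := covering_unique hX covB.
  by rewrite (card_aut hX f_inj U20 sz20 U_auts auts_ok).
pose f0 (i : 'I_11) : X := enum_val (cast_ord (esym hX) i).
have f0_inj : injective f0 by move=> i j /enum_val_inj/cast_ord_inj.
pose B0 := design f0 cov20; have covB0 := design_cov20 hX f0_inj.
(* All coverings form a single orbit, so their number follows from the orbit-stabiliser theorem. *)
have class_cov : coverings X 3 11 5 20 = covering_class B0.
  apply/setP=> B; apply/idP/idP=> [covB|/orbitP[s _ <-]].
    have [f [f_inj ->]] := covering_unique hX covB.
    exact: design_orbit.
  rewrite -design_act; apply: (design_cov20 hX).
  by apply: inj_comp f0_inj; exact: perm_inj.
split; [|exact: aut240|].
  suff -> : [set covering_class B | B in coverings X 3 11 5 20]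
            = [set covering_class B0].
    by rewrite cards1.
  apply/setP=> C; rewrite inE; apply/imsetP/eqP=> [[B covB ->]|->].
    by apply/orbit_eqP; rewrite -/(covering_class B0) -class_cov.
  by exists B0.
have := card_orbit_stab ('P^*^*)%act [set: {perm X}] B0.
rewrite -[orbit _ _ _]/(covering_class B0) -class_cov setTI.
rewrite [#|'C[_ | _]%g|](aut240 _ covB0).
rewrite card_permT hX fact11; apply: muln_pcancel; exact: isT.
Qed.
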